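(* Let $R$ be a ring. The following are equivalent: (1) $R$ is a regular 2-$\Delta U$ ring. (2) $R$ is a $\pi$-regular reduced 2-$\Delta U$ ring. (3) $x^3=x$ for every $x\in R$.
   Context: Rings are associative with identity, not necessarily commutative. $U(R)$ is the group of units of $R$. $\Delta(R)=\{r\in R : r+U(R)\subseteq U(R)\}$. A ring $R$ is called 2-$\Delta U$ if $u^2\in 1+\Delta(R)$ for every $u\in U(R)$. $R$ is (von Neumann) regular if for every $a\in R$ there is $x\in R$ with $axa=a$; $R$ is $\pi$-regular if for each $a\in R$ there is an integer $n\geq 1$ with $a^n\in a^nRa^n$; $R$ is reduced if it has no nonzero nilpotent elements. *)

(* Defs.v *)
From mathcomp Require Import all_boot all_algebra.

Set Implicit Arguments.
Unset Strict Implicit.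
Unset Printing Implicit Defensive.

Import GRing.Theory.
Local Open Scope ring_scope.

(* Rings are [pzRingType]: associative, unital, not necessarily commutative,
   with the zero ring allowed. [GRing.unit] is only available on
   [unitRingType], which excludes the zero ring and asks for a boolean unit
   test, so two-sided invertibility is spelled out here. *)
Definition is_unit (R : pzRingType) (u : R) : Prop :=
  exists v : R, v * u = 1 /\ u * v = 1.

Definition Delta (R : pzRingType) (r : R) : Prop :=
  forall u : R, is_unit u -> is_unit (r + u).

Definition two_DeltaU (R : pzRingType) : Prop :=
  forall u : R, is_unit u -> exists2 d : R, Delta d & u ^+ 2 = 1 + d.

Definition regular_ring (R : pzRingType) : Prop :=
  forall a : R, exists x : R, a * x * a = a.

Definition pi_regular_ring (R : pzRingType) : Prop :=
  forall a : R, exists n : nat,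
    (1 <= n)%N /\ exists x : R, a ^+ n = a ^+ n * x * a ^+ n.

Definition reduced_ring (R : pzRingType) : Prop :=
  forall (a : R) (n : nat), a ^+ n = 0 -> a = 0.

(* Main.v *)
Require Import Defs.
From mathcomp Require Import all_boot all_algebra.

Set Implicit Arguments.
Unset Strict Implicit.
Unset Printing Implicit Defensive.

Import GRing.Theory.
Local Open Scope ring_scope.

(** In a 2-[Delta]U ring the only root of [t^3 + t^2 = t] is [0]. A nonzero
    square-zero element of a regular ring would generate a copy of 2x2 matrix
    units, hence such a nonzero root (the matrix [[0, 1], [1, -1]]); so a
    regular 2-[Delta]U ring is reduced. In a reduced pi-regular ring idempotents
    are central and every element is a central idempotent times a unit. Hence
    [Delta] vanishes, every unit squares to [1], and [x = e u] gives
    [x^3 = e u^3 = x]. *)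

Lemma is_unitN (R : pzRingType) (u : R) : is_unit u -> is_unit (- u).
Proof. by case=> v [vu uv]; exists (- v); rewrite !mulrNN. Qed.

Lemma is_unit_mulI (R : pzRingType) (u a : R) :
  is_unit u -> u * a = 0 -> a = 0.
Proof. by case=> v [vu _] ua0; rewrite -[a]mul1r -vu -mulrA ua0 mulr0. Qed.

(* [1 + t] is a unit with inverse [1 - t^2], so [2t + t^2] is in [Delta];
   subtracting [1 + t], the annihilator [t^2 + t - 1] of [t] is a unit. *)
Lemma two_DeltaU_root0 (R : pzRingType) (t : R) :
  two_DeltaU R -> t * t * t + t * t = t -> t = 0.
Proof.
move=> DU tE.
have t3 : t * t * t = t - t * t by apply: (addIr (t * t)); rewrite subrK.
have Uu : is_unit (1 + t).
  exists (1 - t * t); split.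
    by rewrite mulrDr mulr1 mulrBl mul1r t3 subKr subrK.
  by rewrite mulrDl mul1r mulrBr mulr1 mulrA t3 subKr subrK.
have [d Dd u2] := DU _ Uu.
apply: (is_unit_mulI (Dd _ (is_unitN Uu))).
have -> : d = t + (t + t * t).
  by apply: (addrI 1); rewrite -u2 expr2 mulrDl mul1r mulrDr mulr1 -addrA.
rewrite opprD [- 1 - t]addrC [t + (_ + _)]addrC addrA addrK.
by rewrite mulrBl mul1r mulrDl addrC [t * t + _]addrC tE addNr.
Qed.

(** With [f = x * a], the inner inverse [x] is truncated to [f * x * (1 - f)]: [f * a = 0] keeps
    [y * a = f], while [(1 - f) * f = 0] forces [y * y = 0]. *)
Lemma regular_matrix_units (R : pzRingType) (a : R) :
    regular_ring R -> a * a = 0 ->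
  exists y : R, [/\ a * y * a = a, y * a * y = y & y * y = 0].
Proof.
move=> reg aa; have [x axa] := reg a.
pose f := x * a.
have ff : f * f = f by rewrite /f mulrA -(mulrA x) -mulrA mulrA -mulrA axa.
have fa : f * a = 0 by rewrite /f -mulrA aa mulr0.
have ya : f * x * (1 - f) * a = f.
  by rewrite -mulrA mulrBl mul1r fa subr0 -mulrA.
have af : a * f = a by rewrite /f mulrA.
clearbody f.
exists (f * x * (1 - f)); split.
- by rewrite -mulrA ya.
- by rewrite ya 2!mulrA ff.
- by rewrite -!mulrA (mulrA (1 - f) f) mulrBl mul1r ff subrr mul0r !mulr0.
Qed.

Lemma regular_two_DeltaU_sq0 (R : pzRingType) (a : R) :
  regular_ring R -> two_DeltaU R -> a * a = 0 -> a = 0.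
Proof.
move=> reg DU aa; have [y [aya yay yy]] := regular_matrix_units reg aa.
(* Reading [a], [y], [e], [f] as the matrix units E12, E21, E11, E22, [t] is the matrix of the
   overview and [e + f] the identity of the block. *)
pose e := a * y; pose f := y * a; pose t := a + y - f.
have fa : f * a = 0 by rewrite /f -mulrA aa mulr0.
have fy : f * y = y by [].
have yf : y * f = 0 by rewrite /f mulrA yy mul0r.
have af : a * f = a by rewrite /f mulrA aya.
have ff : f * f = f by rewrite {1}/f -mulrA af.
have ae : a * e = 0 by rewrite /e mulrA aa mul0r.
have ye : y * e = y by rewrite /e mulrA yay.
have fe : f * e = 0 by rewrite /f -mulrA ae mulr0.
have t2 : t * t + t = e + f.
  have -> : t * t = e + f - t.
    rewrite {1 2}/t mulrBr 2!mulrBl !mulrDl !mulrDr aa yy fa fy af yf ff.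
    rewrite -/e -/f add0r !addr0 add0r /t.
    by rewrite -[LHS]addrA -opprD [y + _]addrA [y + a]addrC.
  by rewrite subrK.
(* Compression recovers [a] from [t]: [a * t * a = a * y * a = a]. *)
suff t0 : t = 0.
  have : a * t * a = 0 by rewrite t0 mulr0 mul0r.
  by rewrite /t mulrBr mulrDr aa add0r af mulrBl aa subr0 aya.
apply: two_DeltaU_root0 => //.
rewrite -mulrA -mulrDr t2 {1}/t mulrBl mulrDl !mulrDr ae af ye yf fe ff.
by rewrite !add0r addr0.
Qed.

Lemma sq0_reduced (R : pzRingType) :
  (forall a : R, a * a = 0 -> a = 0) -> reduced_ring R.
Proof.
(* Exponent [0] means [1 = 0], so the ring is trivial. *)
move=> sq0 a [|n] an0; first by rewrite -[a]mulr1 -(expr0 a) an0 mulr0.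
elim: n an0 => [|n IHn] an0; first by rewrite -[a]expr1.
apply/IHn/sq0.
by rewrite -exprD -addSnnS exprD an0 mul0r.
Qed.

(** The off-diagonal Peirce components [e * r * (1 - e)] and [(1 - e) * r * e] square to zero. *)
Lemma reduced_idem_central (R : pzRingType) (e : R) :
  reduced_ring R -> e * e = e -> forall r : R, e * r = r * e.
Proof.
move=> red ee r.
have ce : (1 - e) * e = 0 by rewrite mulrBl mul1r ee subrr.
have ec : e * (1 - e) = 0 by rewrite mulrBr mulr1 ee subrr.
have h1 : e * r * (1 - e) = 0.
  by apply: (red _ 2); rewrite expr2 -!mulrA (mulrA (1 - e) e) ce mul0r !mulr0.
have h2 : (1 - e) * r * e = 0.
  by apply: (red _ 2); rewrite expr2 -!mulrA (mulrA e (1 - e)) ec mul0r !mulr0.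
have /subr0_eq -> : e * r - e * r * e = 0 by rewrite -{1}[e * r]mulr1 -mulrBr.
by symmetry; apply: subr0_eq; rewrite -mulrBl -{1}[r]mul1r -mulrBl.
Qed.

(** The element [a] is invertible in the corner [e R]; adding [1 - e] extends it to a unit of
    [R]. *)
Lemma pi_regular_reduced_decomp (R : pzRingType) (a : R) :
    pi_regular_ring R -> reduced_ring R ->
  exists e u : R,
    [/\ e * e = e, forall r : R, e * r = r * e, is_unit u & a = e * u].
Proof.
move=> pireg red; have [m [m_gt0 [x]]] := pireg a.
case: m m_gt0 => // n _ ax.
set b := a ^+ n.+1 in ax.
pose e := b * x; pose g := x * b.
have ee : e * e = e by rewrite /e mulrA -ax.
have gg : g * g = g by rewrite /g -mulrA (mulrA b x) -ax.
have eC := reduced_idem_central red ee.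
have gC := reduced_idem_central red gg.
have eb : e * b = b by rewrite /e -ax.
have bg : b * g = b by rewrite /g mulrA -ax.
have eg : e = g.
  have -> : e = g * e by rewrite {2}/e mulrA gC bg.
  by rewrite -eC {1}/g mulrA eC -mulrA eb.
(* The difference [(e - 1) * a] is nilpotent: [e] is central and [(e - 1) * b = 0]. *)
have ae : a = e * a.
  apply/esym/subr0_eq/(red _ n.+1).
  have -> : e * a - a = (e - 1) * a by rewrite mulrBl mul1r.
  rewrite exprMn_comm; last by rewrite /GRing.comm mulrBl mulrBr mul1r mulr1 eC.
  by rewrite exprSr -mulrA mulrBl mul1r -/b eb subrr mulr0.
have eae : a * e = a by rewrite -eC.
have ab : a * a ^+ n * x = e by rewrite /e /b exprS.
have ba : x * a ^+ n * a = e by rewrite eg /g /b exprSr mulrA.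
(* In the corner, [a ^+ n * x] is a right inverse of [a] and [x * a ^+ n] a left one; [cE] is the
   usual proof that they agree. *)
pose c := e * (a ^+ n * x).
have cE : c = x * a ^+ n * e.
  by rewrite /c -{1}ba -ab -!mulrA.
have ec : e * c = c by rewrite /c mulrA ee.
have ac : a * c = e by rewrite /c mulrA eae mulrA ab.
have ca : c * a = e by rewrite cE -mulrA -ae ba.
exists e, (a + (1 - e)); split=> //; last first.
  by rewrite mulrDr -ae mulrBr mulr1 ee subrr addr0.
have e'e' : (1 - e) * (1 - e) = 1 - e.
  by rewrite mulrBr mulr1 mulrBl mul1r ee subrr subr0.
have corner z : e * z = z -> (1 - e) * z = 0 /\ z * (1 - e) = 0.
  by move=> ez; rewrite mulrBl mulrBr mulr1 mul1r -eC ez subrr.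
have [e'a ae'] := corner a (esym ae).
have [e'c ce'] := corner c ec.
exists (c + (1 - e)).
split.
  by rewrite mulrDl !(mulrDr _ a) e'e' e'a ce' ca addr0 add0r addrC subrK.
by rewrite mulrDl !(mulrDr _ c) e'e' e'c ae' ac addr0 add0r addrC subrK.
Qed.

(** Writing [d = e * u], the unit [d - u] is killed by [e]. *)
Lemma pi_regular_reduced_Delta0 (R : pzRingType) (d : R) :
  pi_regular_ring R -> reduced_ring R -> Delta d -> d = 0.
Proof.
move=> pireg red Dd.
have [e [u [ee eC Uu dE]]] := pi_regular_reduced_decomp d pireg red.
suff e0 : e = 0 by rewrite dE e0 mul0r.
apply: (is_unit_mulI (Dd _ (is_unitN Uu))).
by rewrite -eC mulrDr dE mulrA ee mulrN subrr.
Qed.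

Theorem theorem3p19 (R : pzRingType) :
  [<-> regular_ring R /\ two_DeltaU R;
       pi_regular_ring R /\ reduced_ring R /\ two_DeltaU R;
       forall x : R, x ^+ 3 = x].
Proof.
tfae.
- case=> reg DU; split=> [a|].
    by exists 1%N; split=> //; have [x axa] := reg a; exists x; rewrite expr1.
  split=> //; apply: sq0_reduced => a; exact: regular_two_DeltaU_sq0.
- case=> pireg [red DU] a.
  have [e [u [ee eC Uu ->]]] := pi_regular_reduced_decomp a pireg red.
  have [d Dd] := DU u Uu.
  rewrite (pi_regular_reduced_Delta0 pireg red Dd) addr0 => u2.
  rewrite exprMn_comm; last exact: eC.
  by rewrite (exprS u) u2 mulr1 2!exprS expr1 !ee.
- move=> cube; split=> [a|u [v [vu _]]].
    by exists a; rewrite -[RHS]cube !exprS expr0 mulr1 mulrA.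
  (* Cancelling [u] in [u ^+ 3 = u] gives [u ^+ 2 = 1]. *)
  exists 0; first by move=> w; rewrite add0r.
  by rewrite addr0 -[u ^+ 2]mul1r -vu -mulrA -exprS cube.
Qed.
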